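(* Let $E$ be an infinite-dimensional real normed space and let $m\in\mathbb{N}$. For every $n\in\mathbb{N}$, the set $\mathcal{NL}(^{m}E;\mathbb{R})$ is $(n,2^{\dim E})$-lineable in $L(^{m}E;\mathbb{R})$. Moreover, $2^{\dim E}$ cannot be replaced with a bigger cardinal number; that is, if $\beta$ is a cardinal with $\beta>2^{\dim E}$, then $\mathcal{NL}(^{m}E;\mathbb{R})$ is not $(n,\beta)$-lineable in $L(^{m}E;\mathbb{R})$.
   Context: $\mathbb{N}=\{1,2,\dots\}$. For a vector space $V$, $\dim V$ denotes its algebraic (Hamel) dimension, a cardinal number. For real normed spaces $E,F$ and $m\in\mathbb{N}$, $L(^{m}E;F)$ is the vector space of all $m$-linear operators $E\times\cdots\times E\to F$ ($m$ factors, continuous or not), and $\mathcal{NL}(^{m}E;F)\subset L(^{m}E;F)$ is the set of all non-continuous ones. For a cardinal $\beta$, a subset $A$ of a vector space $V$ is $\beta$-lineable in $V$ if $A\cup\{0\}$ contains a $\beta$-dimensional linear subspace of $V$. For cardinals $\alpha<\beta$, $A$ is $(\alpha,\beta)$-lineable in $V$ if $A$ is $\alpha$-lineable in $V$ and for every linear subspace $W_\alpha\subset V$ with $W_\alpha\subset A\cup\{0\}$ and $\dim W_\alpha=\alpha$ there is a linear subspace $W_\beta\subset V$ with $\dim W_\beta=\beta$ and $W_\alpha\subset W_\beta\subset A\cup\{0\}$. *)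

(* Defs.v *)
From HB Require Import structures.
From mathcomp Require Import all_boot all_order all_algebra.
From mathcomp Require Import all_classical all_reals all_analysis.

Set Implicit Arguments.
Unset Strict Implicit.
Unset Printing Implicit Defensive.
Import Order.TTheory GRing.Theory Num.Theory.
Import numFieldNormedType.Exports.
Local Open Scope classical_set_scope.
Local Open Scope card_scope.
Local Open Scope ring_scope.

(* A cardinal number is represented by an arbitrary set B : set T over an
   arbitrary type, up to equipotence (#=): the finite cardinal n is `I_n and
   2 ^ B is the power set of B. *)
Definition card_lt (T U : Type) (A : set T) (B : set U) : Prop :=
  (A #<= B) /\ ~ (B #<= A).

Definition card_pow2 (T : Type) (B : set T) : set (set T) :=
  [set X | X `<=` B].

Section Dimension.
Variables (R : realType) (V : lmodType R).

Definition linear_subspace (W : set V) : Prop :=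
  GRing.submod_closed (fun x => x \in W).

Definition lin_indep (B : set V) : Prop :=
  forall (s : seq V) (c : V -> R), uniq s -> [set` s] `<=` B ->
    \sum_(x <- s) c x *: x = 0 -> forall x, x \in s -> c x = 0.

Definition lin_span (B : set V) : set V :=
  [set v | exists (s : seq V) (c : V -> R),
             [set` s] `<=` B /\ v = \sum_(x <- s) c x *: x].

Definition hamel_basis (W B : set V) : Prop :=
  lin_indep B /\ lin_span B = W.

Definition has_dim (T : Type) (W : set V) (k : set T) : Prop :=
  exists2 B : set V, hamel_basis W B & B #= k.

Definition lineable (T : Type) (b : set T) (A : set V) : Prop :=
  exists W : set V,
    [/\ linear_subspace W, has_dim W b & W `<=` A `|` [set 0]].

Definition lineable2 (T U : Type) (a : set T) (b : set U) (A : set V) : Prop :=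
  [/\ card_lt a b, lineable a A &
    forall Wa : set V,
      linear_subspace Wa -> Wa `<=` A `|` [set 0] -> has_dim Wa a ->
      exists Wb : set V, [/\ linear_subspace Wb, has_dim Wb b,
                             Wa `<=` Wb & Wb `<=` A `|` [set 0]]].

End Dimension.

Lemma hamel_basis_exists (R : realType) (V : lmodType R) :
  exists B : set V, hamel_basis [set: V] B.
Proof.
have [F FP Ftot|A [Ai Amax]] := @Zorn_bigcup V (@lin_indep R V).
  move=> s c us sF s0 x xs.
  have [X FX sX] : exists2 X, F X & [set` s] `<=` X.
    have : s != [::] by case: (s) xs.
    elim: s sF {us s0 x xs} => // y s IH sF _.
    have [X FX Xy] := sF y (mem_head _ _).
    have [->|/IH] := eqVneq s [::].
      by exists X => // z; rewrite /= mem_seq1 => /eqP ->.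
    case=> [z zs|Y FY sY]; first by apply: sF; rewrite /= inE zs orbT.
    have [XY|YX] := Ftot _ _ FX FY; [exists Y|exists X] => // z;
      rewrite /= inE => /orP[/eqP->|zs]; auto.
  exact: (FP _ FX s c us sX s0 x xs).
exists A; split=> //; apply/seteqP; split=> // v _; apply: contrapT => nv.
have nAv : ~ A v.
  move=> Av; apply: nv; exists [:: v], (fun=> 1); split.
    by move=> x /=; rewrite mem_seq1 => /eqP ->.
  by rewrite big_seq1 scale1r.
apply: (Amax (A `|` [set v])).
  split; first by move=> x; left.
  by move=> /(_ v)/(_ (or_intror erefl)).
move=> s c us sA s0.
have remA : [set` rem v s] `<=` A.
  move=> x /=; rewrite mem_rem_uniq// inE => /andP[/= xv xs].
  by case: (sA x xs) => // xv'; rewrite xv' eqxx in xv.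
have [vs|vs] := boolP (v \in s); last first.
  by rewrite rem_id// in remA; exact: (Ai s c us remA s0).
move: s0; rewrite (perm_big _ (perm_to_rem vs))/= big_cons => s0.
have cv : c v = 0.
  apply: contrapT => /eqP cv; apply: nv.
  exists (rem v s), (fun x => - (c v)^-1 * c x).
  split=> //; under eq_bigr do rewrite -scalerA.
  rewrite -scaler_sumr; move/eqP: s0; rewrite addrC addr_eq0 => /eqP ->.
  by rewrite scalerN scaleNr opprK scalerA mulVf// scale1r.
move: s0; rewrite cv scale0r add0r => s0 x xs.
have [->//|xv] := eqVneq x v.
apply: (Ai _ c (rem_uniq v us) remA s0).
by rewrite mem_rem_uniq// inE/= xv.
Qed.

Section Multilinear.
Variables (R : realType) (m : nat) (E F : lmodType R).

(* dfwith v i x is the vector v with its i-th coordinate replaced by x. *)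
Definition multilinear (f : ('I_m -> E) -> F) : Prop :=
  forall (v : 'I_m -> E) (i : 'I_m), linear (fun x : E => f (dfwith v i x)).

Definition multilinear_pred : {pred ('I_m -> E) -> F} :=
  fun f => `[< multilinear f >].

Record mlin := MLin {
  mlin_fun :> ('I_m -> E) -> F;
  _ : mlin_fun \in multilinear_pred }.

HB.instance Definition _ := [isSub for mlin_fun].
HB.instance Definition _ := [Choice of mlin by <:].

Fact multilinear_submod_closed : GRing.submod_closed multilinear_pred.
Proof.
split=> [|a f g /asboolP fl /asboolP gl]; apply/asboolP => v i b x y.
  by rewrite scaler0 addr0.
change (a *: f (dfwith v i (b *: x + y)) + g (dfwith v i (b *: x + y)) =
  b *: (a *: f (dfwith v i x) + g (dfwith v i x)) +
  (a *: f (dfwith v i y) + g (dfwith v i y))).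
rewrite fl gl !scalerDr !scalerA (mulrC b a) -!addrA; congr (_ + _).
by rewrite addrCA.
Qed.

HB.instance Definition _ := GRing.isSubmodClosed.Build R (('I_m -> E) -> F)
  multilinear_pred multilinear_submod_closed.
HB.instance Definition _ := [SubChoice_isSubLmodule of mlin by <:].

End Multilinear.

(* Continuity is with respect to the product topology on E^m. *)
Definition NL (R : realType) (m : nat) (E F : normedModType R) :
    set (mlin m E F) :=
  [set f | ~ continuous (f : {ptws 'I_m -> E} -> F)].
Arguments NL {R} m E F.

(* Main.v *)
(* Let C be the space of continuous m-linear forms on E, and T a set indexing a
   Hamel basis of E. Extending prescribed values on the basis linearly yields a
   family of forms h (A, l), for A a subset of T and l a natural number, which
   is linearly independent modulo C. Given an n-dimensional space Wa meeting C
   only at 0, Steinitz exchange modulo C removes finitely many members of this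
   family, after which the rest is independent modulo C + Wa. Some l is not
   affected by the removal, and Wa together with all the h (A, l) for that l
   spans the required space of dimension 2 ^ dim E. Conversely, a form is
   determined by the rationals below its values at tuples of basis vectors, so
   that there are at most 2 ^ dim E forms altogether. *)
Require Import Defs.
From HB Require Import structures.
From mathcomp Require Import all_boot all_order all_algebra.
From mathcomp Require Import all_classical all_reals all_analysis.
Import Order.TTheory GRing.Theory Num.Theory.
Import numFieldNormedType.Exports.
Local Open Scope classical_set_scope.
Local Open Scope card_scope.
Local Open Scope ring_scope.

Set Implicit Arguments.
Unset Strict Implicit.
Unset Printing Implicit Defensive.

(** * Cardinalities of infinite types *)

(** Total functions injective on [A] replace injections between subtypes; the point of [B] serves as
    the value outside [A]. *)
Lemma card_le_injP (T U : Type) (A : set T) (B : set U) : B !=set0 ->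
  A #<= B <-> exists2 f : T -> U, {homo f : x / A x >-> B x} & {in A &, injective f}.
Proof.
case=> b Bb; split=> [|[f fAB finj]].
  move=> /card_leP[f].
  pose g x :=
    if pselect (A x) is left Ax then set_val (f (SigSub (mem_set Ax))) else b.
  exists g.
    by move=> x Ax; rewrite /g; case: pselect => // ?; apply: set_valP.
  move=> x y xA yA; rewrite /g.
  case: pselect => [Ax|]; last by move: xA; rewrite inE.
  case: pselect => [Ay|]; last by move: yA; rewrite inE.
  move=> /val_inj h.
  have : SigSub (mem_set Ax) = SigSub (mem_set Ay) :> set_type A.
    by apply: (@inj _ _ _ f) => //; rewrite inE.
  by case.
rewrite -(card_le_eql (inj_card_eq finj)); apply: subset_card_le.
by move=> _ [x Ax <-]; exact: fAB.
Qed.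

Lemma card_leT_injP (T U : Type) : inhabited U ->
  [set: T] #<= [set: U] <-> exists f : T -> U, injective f.
Proof.
case=> u; rewrite card_le_injP; last by exists u.
split=> [[f _ fi]|[f fi]]; exists f => //.
- by move=> x y; apply: fi; rewrite inE.
- by move=> x y _ _; exact: fi.
Qed.

(** Zorn's lemma gives a maximal partial injection between [A] and [B]. If it missed both a point of
    [A] and a point of [B], this pair could be added to its graph. *)
Lemma card_le_total (T U : Type) (A : set T) (B : set U) : A #<= B \/ B #<= A.
Proof.
have [->|/set0P A0] := eqVneq A set0; first by left; exact: card_ge0.
have [->|/set0P B0] := eqVneq B set0; first by right; exact: card_ge0.
pose P : set (set (T * U)) := [set G | G `<=` A `*` B /\
  (forall p q, G p -> G q -> p.1 = q.1 <-> p.2 = q.2)].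
have [F FP Ftot|G [[GAB Ginj] Gmax]] := @Zorn_bigcup _ P.
  split=> [p [G FG Gp]|p q [G FG Gp] [G' FG' G'q]]; first exact: (FP _ FG).1.
  by have [/(_ _ Gp) G'p|/(_ _ G'q) Gq] := Ftot _ _ FG FG';
    [apply: (FP _ FG').2|apply: (FP _ FG).2].
have funof (T' U' : Type) (D : set T') (b : U') (S : T' -> U' -> Prop) :
    (forall x, D x -> exists y, S x y) -> exists f, forall x, D x -> S x (f x).
  move=> h; suff /choice[f fP] : forall x, exists y, D x -> S x y by exists f.
  by move=> x; have [/h[y]|nDx] := pselect (D x); [exists y|exists b].
have [Afull|/existsNP[x /not_implyP[Ax nx]]] :=
    pselect (forall x, A x -> exists y, G (x, y)).
  left; apply/(card_le_injP _ B0); case: B0 => b _.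
  have [f fP] := funof _ _ _ b _ Afull; exists f => [x /fP/GAB[]//|x y].
  by rewrite !inE => /fP Gx /fP Gy /(Ginj _ _ Gx Gy).
have [Bfull|/existsNP[y /not_implyP[By ny]]] :=
    pselect (forall y, B y -> exists x, G (x, y)).
  right; apply/(card_le_injP _ A0); case: A0 => a _.
  have [f fP] := funof _ _ _ a _ Bfull; exists f => [y /fP/GAB[]//|y z].
  by rewrite !inE => /fP Gx /fP Gy /(Ginj _ _ Gx Gy).
exfalso; apply: (Gmax (G `|` [set (x, y)])).
  split=> [|/(_ (x, y) (or_intror erefl)) Gxy]; first by move=> ?; left.
  by apply: nx; exists y.
split=> [p [/GAB//|->]//|p q [Gp|->] [Gq|->]]; first exact: Ginj.
- split=> /= e; exfalso.
    by apply: nx; exists p.2; rewrite -e -surjective_pairing.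
  by apply: ny; exists p.1; rewrite -e -surjective_pairing.
- split=> /= e; exfalso.
    by apply: nx; exists q.2; rewrite e -surjective_pairing.
  by apply: ny; exists q.1; rewrite e -surjective_pairing.
- by [].
Qed.

(** Zorn's lemma is applied to the sets whose union with [A0] satisfies [P]. The empty chain is
    treated apart, its union with [A0] being [A0] itself. *)
Lemma Zorn_bigcup_above (T : Type) (P : set (set T)) (A0 : set T) : P A0 ->
  (forall F : set (set T), F `<=` P -> total_on F subset ->
    P (\bigcup_(X in F) X)) ->
  exists A, [/\ P A, A0 `<=` A & forall B, A `<` B -> ~ P B].
Proof.
move=> PA0 Pcup.
have [F FP Ftot|A [PA Amax]] := @Zorn_bigcup _ [set A | P (A0 `|` A)].
  have [->|/set0P[A FA]] := eqVneq F set0.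
    by rewrite /= bigcup_set0 setU0.
  rewrite /= -(_ : \bigcup_(X in [set A0 `|` X | X in F]) X =
      A0 `|` \bigcup_(X in F) X).
    apply: Pcup => [_ [X FX <-]|_ _ [X FX <-] [Y FY <-]]; first exact: FP.
    by have [h|h] := Ftot _ _ FX FY; [left|right]; exact: setUS.
  rewrite bigcup_image; apply/seteqP; split.
    by move=> x [X FX [?|?]]; [left|right; exists X].
  by move=> x [?|[X FX Xx]]; [exists A => //; left|exists X => //; right].
exists (A0 `|` A); split=> // B [A0AB nBA] PB; apply: (Amax (A0 `|` B)).
  split=> [x Ax|h]; first by right; apply: A0AB; right.
  by apply: nBA => x Bx; right; apply: h; right.
by rewrite /= setUA setUid (setUidr (subset_trans (@subsetUl _ _ _) A0AB)).
Qed.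

(* Zorn's lemma gives a maximal injection f : X * X -> X with X infinite.
   If T \ X had at least the size of X, a copy Y of X inside T \ X would have
   room for the three remaining quarters of (X u Y) * (X u Y), which would
   extend f; hence T has the size of X. *)
Lemma infinite_square_inj (T : Type) : infinite_set [set: T] ->
  exists f : T * T -> T, injective f.
Proof.
move=> Tinf.
have [t _] := infinite_setN0 Tinf.
have /(card_leT_injP _ (inhabits t))[i0 i0inj] : [set: nat] #<= [set: T].
  exact/infiniteP.
have [j jinj] : exists j : nat * nat -> nat, injective j.
  apply/(card_leT_injP _ (inhabits 0%N)).
  by move: card_nat2; rewrite card_eq_le => /andP[].
pose X (G : set (T * T * T)) := [set x | exists y z, G (x, y, z)].
(* Starting from a copy of a pairing of the natural numbers puts every [i0 n] into [X G]; these
   points serve as tags below. *)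
pose G0 : set (T * T * T) := [set (i0 p.1, i0 p.2, i0 (j p)) | p in setT].
(* The members of [P] are the graphs of injections from [X G * X G] to [X G]; the last clause
   combines functionality and injectivity. *)
pose P : set (set (T * T * T)) := [set G | [/\
  forall x y, X G x -> X G y -> exists2 z, X G z & G (x, y, z),
  forall p, G p -> X G p.1.2 &
  forall p q, G p -> G q -> p.1 = q.1 <-> p.2 = q.2]].
have XS (G G' : set (T * T * T)) : G `<=` G' -> X G `<=` X G'.
  by move=> GG' x [y [z /GG' h]]; exists y, z.
have [||G [[Gdef Gdom Ginj] G0G Gmax]] := @Zorn_bigcup_above _ P G0.
- have XG0 n : X G0 (i0 n) by exists (i0 n), (i0 (j (n, n))), (n, n).
  split.
  + move=> _ _ [_ [_ [[n ?] _ [<- _ _]]]] [_ [_ [[k ?] _ [<- _ _]]]] /=.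
    by exists (i0 (j (n, k))) => //; exists (n, k).
  + by move=> _ [p _ <-]; exact: XG0.
  + move=> _ _ [p _ <-] [q _ <-] /=; split=> [[/i0inj e /i0inj e']|/i0inj/jinj->//].
    by rewrite (surjective_pairing p) e e' -surjective_pairing.
- move=> F FP Ftot.
  have Fsub A : F A -> A `<=` \bigcup_(A in F) A by move=> FA x Ax; exists A.
  have XF x : X (\bigcup_(A in F) A) x -> exists2 A, F A & X A x.
    by move=> [y [z [A FA Axyz]]]; exists A => //; exists y, z.
  split.
  + move=> x y /XF[A FA Ax] /XF[B FB By].
    suff [D [FD Dx Dy]] : exists D, [/\ F D, X D x & X D y].
      have [+ _ _] := FP _ FD => /(_ x y Dx Dy)[z Dz Dxyz].
      by exists z; [exact: XS (Fsub _ FD) _ Dz|exists D].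
    by have [AB|BA] := Ftot _ _ FA FB; [exists B|exists A]; split=> //;
      [exact: XS AB _ Ax|exact: XS BA _ By].
  + by move=> p [A FA Ap]; apply: (XS _ _ (Fsub _ FA));
      have [_ + _] := FP _ FA; exact.
  + move=> p q [A FA Ap] [B FB Bq].
    by have [/(_ _ Ap) Bp|/(_ _ Bq) Aq] := Ftot _ _ FA FB;
     [have [_ _] := FP _ FB|have [_ _] := FP _ FA]; exact.
have [f fP] : exists f : T * T -> T,
    forall p, X G p.1 -> X G p.2 -> X G (f p) /\ G (p, f p).
  suff /choice[f fP] : forall p, exists z,
    X G p.1 -> X G p.2 -> X G z /\ G (p, z) by exists f.
  move=> [x y] /=.
  have [[Xx Xy]|nX] := pselect (X G x /\ X G y).
    by have [z Xz Gz] := Gdef _ _ Xx Xy; exists z.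
  by exists t => Xx Xy; case: nX.
have finj p q : X G p.1 -> X G p.2 -> X G q.1 -> X G q.2 -> f p = f q -> p = q.
  move=> p1 p2 q1 q2; have [_ Gp] := fP _ p1 p2; have [_ Gq] := fP _ q1 q2.
  by case: (Ginj _ _ Gp Gq) => _ /=.
have Xi0 n : X G (i0 n).
  by apply: XS G0G _ _; exists (i0 n), (i0 (j (n, n))), (n, n).
have [XgeC|CgeX] := card_le_total (~` X G) (X G).
  have XG0 : X G !=set0 by exists (i0 0%N).
  have [h hX hinj] := (card_le_injP _ XG0).1 XgeC.
  (* The tags [i0 0] and [i0 1] keep the images of [X G] and of its complement apart, so that all of
     [T] embeds into [X G], where [f] pairs. *)
  pose k x := if pselect (X G x) is left _ then f (x, i0 0%N) else f (h x, i0 1%N).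
  have kX x : X G (k x).
    rewrite /k; case: pselect => Xx; first by have [] := fP (x, i0 0%N) Xx (Xi0 _).
    by have [] := fP (h x, i0 1%N) (hX _ Xx) (Xi0 _).
  have kinj : injective k.
    move=> x y; rewrite /k; case: pselect => Xx; case: pselect => Xy;
      move=> /finj; (do 4 (move=> /(_ ltac:(by [|exact: hX|exact: Xi0])))).
    - by case.
    - by case=> _ /i0inj.
    - by case=> _ /i0inj.
    - by case=> /hinj; apply; rewrite inE.
  exists (fun p => f (k p.1, k p.2)) => -[x y] [x' y'] /=.
  by move=> /(finj (_, _) (_, _) (kX _) (kX _) (kX _) (kX _))[/kinj-> /kinj->].
exfalso.
have [XC|/set0P C0] := eqVneq (~` X G) set0.
  by move: CgeX; rewrite XC card_le0 => /eqP X0; have := Xi0 0; rewrite X0.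
have [h hX hinj] := (card_le_injP _ C0).1 CgeX.
pose Y := X G `|` h @` X G.
(* [pi] decodes a point of [Y] into a point of [X G] and a flag marking the copy of [X G] under
   [h]. *)
have [pi piP] : exists pi : T -> T * bool, forall x, Y x ->
    X G (pi x).1 /\ x = if (pi x).2 then h (pi x).1 else (pi x).1.
  suff /choice[f' f'P] : forall x, exists u, Y x ->
    X G u.1 /\ x = if u.2 then h u.1 else u.1 by exists f'.
  move=> x.
  have [Xx|nX] := pselect (X G x); first by exists (x, false).
  have [[y Xy <-]|nY] := pselect ((h @` X G) x); first by exists (y, true).
  by exists (t, true) => -[].
pose code (a b : bool) := i0 (a + b.*2)%N.
(* [g] agrees with [f] on [X G * X G]. On the rest of [Y * Y] its values lie in the copy under [h],
   away from those of [f], and the tag [code] records which coordinates came from the copy. *)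
pose g (p : T * T) := let: (a, b) := (pi p.1, pi p.2) in
  if a.2 || b.2 then h (f (f (a.1, b.1), code a.2 b.2)) else f p.
have piX x : Y x -> X G (pi x).1 by move=> /piP[].
have piE x : Y x -> x = if (pi x).2 then h (pi x).1 else (pi x).1.
  by move=> /piP[].
have piXF x : X G x -> (pi x).2 = false.
  move=> Xx; have [] := piP x (or_introl Xx).
  by case: (pi x).2 => // /hX + xE; rewrite -xE.
have unflag x y : Y x -> Y y -> (pi x).2 || (pi y).2 = false -> X G x /\ X G y.
  move=> Yx Yy /norP[]; have [] := piP x Yx; have [] := piP y Yy.
  by do 2!case: (pi _).2 => //; move=> + -> + ->.
pose w x y := f (f ((pi x).1, (pi y).1), code (pi x).2 (pi y).2).
have Xf x y : Y x -> Y y -> X G (f ((pi x).1, (pi y).1)).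
  by move=> Yx Yy; have [] := fP ((pi x).1, (pi y).1) (piX _ Yx) (piX _ Yy).
have gP x y : Y x -> Y y -> [/\ X G (w x y) & g (x, y) = h (w x y)] \/
    [/\ X G x, X G y & g (x, y) = f (x, y)].
  move=> Yx Yy; rewrite /g /= -/(w x y).
  case: (boolP ((pi x).2 || (pi y).2)) => [_|/negbTE/(unflag _ _ Yx Yy)[]];
    last by right.
  left; split=> //.
  by have [] := fP (f ((pi x).1, (pi y).1), code (pi x).2 (pi y).2)
    (Xf _ _ Yx Yy) (Xi0 _).
have ginj x y x' y' : Y x -> Y y -> Y x' -> Y y' ->
    g (x, y) = g (x', y') -> (x, y) = (x', y').
  move=> Yx Yy Yx' Yy'.
  have [[Xw ->]|[Xx Xy ->]] := gP x y Yx Yy;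
    have [[Xw' ->]|[Xx' Xy' ->]] := gP x' y' Yx' Yy'.
  - move=> /(hinj _ _ (mem_set Xw) (mem_set Xw')).
    move=> /(finj (_, _) (_, _) (Xf _ _ Yx Yy) (Xi0 _) (Xf _ _ Yx' Yy') (Xi0 _))[].
    move=> /(finj (_, _) (_, _) (piX _ Yx) (piX _ Yy) (piX _ Yx') (piX _ Yy'))[].
    move=> ex ey /i0inj c.
    rewrite (piE _ Yx) (piE _ Yy) (piE _ Yx') (piE _ Yy') ex ey.
    by move: c; case: (pi x).2; case: (pi x').2; case: (pi y).2; case: (pi y').2.
  - move=> hf; case: (hX _ Xw); rewrite hf.
    by have [] := fP (x', y') Xx' Xy'.
  - move=> hf; case: (hX _ Xw'); rewrite -hf.
    by have [] := fP (x, y) Xx Xy.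
  - exact: finj.
pose G' := [set p : T * T * T | [/\ Y p.1.1, Y p.1.2 & p.2 = g p.1]].
have XG' x : X G' x <-> Y x.
  by split=> [[y [z []]]//|Yx]; exists x, (g (x, x)); split.
apply: (Gmax G'); first split.
- move=> [[x y] z] Gp.
  have Xx : X G x by exists y, z.
  have Xy : X G y := Gdom _ Gp.
  split; [by left|by left|].
  rewrite /g /= !piXF//=.
  by have [_ Gf] := fP (x, y) Xx Xy; apply: (Ginj _ _ Gp Gf).1.
(* The extension is proper because [h] takes its values outside [X G]. *)
- have Yh : Y (h (i0 0%N)) by right; exists (i0 0%N).
  move=> G'G.
  have /G'G Gh : G' (h (i0 0%N), h (i0 0%N), g (h (i0 0%N), h (i0 0%N))) by split.
  by apply: (hX _ (Xi0 0)); exists (h (i0 0%N)), (g (h (i0 0%N), h (i0 0%N))).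
split.
- move=> x y /XG' Yx /XG' Yy; exists (g (x, y)); last by split.
  apply/XG'; have [[Xw ->]|[Xx Xy ->]] := gP x y Yx Yy.
    by right; exists (w x y).
  by left; have [] := fP (x, y) Xx Xy.
- by move=> p [_ /XG' ? _].
- move=> [[x y] z] [[x' y'] z'] [/= Yx Yy ->] [/= Yx' Yy' ->].
  by split=> [[-> ->]//|]; exact: ginj.
Qed.

Section InfiniteType.
Variable T : Type.
Hypothesis Tinf : infinite_set [set: T].

Lemma infinite_nat_inj : exists f : nat -> T, injective f.
Proof.
have [t _] := infinite_setN0 Tinf.
exact/(card_leT_injP _ (inhabits t))/infiniteP.
Qed.

Lemma infinite_prod_inj (U V : Type) :
  (exists f : U -> T, injective f) -> (exists f : V -> T, injective f) ->
  exists f : U * V -> T, injective f.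
Proof.
move=> [f fi] [g gi]; have [p pi] := infinite_square_inj Tinf.
by exists (fun x => p (f x.1, g x.2)) => -[x y] [x' y'] /pi[/fi-> /gi->].
Qed.

Lemma infinite_countable_inj (U : countType) : exists f : U -> T, injective f.
Proof.
have [f fi] := infinite_nat_inj.
by exists (f \o pickle); apply: inj_comp fi (pcan_inj pickleK).
Qed.

Lemma infinite_seq_inj (U : Type) : (exists f : U -> T, injective f) ->
  exists f : seq U -> T, injective f.
Proof.
move=> [f fi]; have [p pi] := infinite_square_inj Tinf.
have [i ii] := infinite_nat_inj.
pose c := foldr (fun x a => p (f x, a)) (i 0%N).
(* The length is stored as well, since the code [i 0] of the empty list may also be a value of
   [p]. *)
exists (fun s => p (i (size s), c s)) => s t /pi[/ii].
by elim: s t => [|x s IH] [|y t]//= [/IH{}IH] /pi[/fi-> /IH->].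
Qed.

End InfiniteType.

Lemma image_set_inj (T U : Type) : (exists f : T -> U, injective f) ->
  exists f : set T -> set U, injective f.
Proof.
move=> [f fi]; exists (fun A => f @` A) => A B AB; apply/funext => x.
by rewrite -(image_inj fi (A := A)) AB (image_inj fi).
Qed.

Lemma inj_left_inverse (T U : Type) (f : T -> U) : inhabited T -> injective f ->
  exists g : U -> T, cancel f g.
Proof.
move=> [t] fi.
have /choice[g gP] u : exists x, forall y, f y = u -> x = y.
  have [[y yu]|nu] := pselect (exists y, f y = u).
    by exists y => y'; rewrite -yu => /fi.
  by exists t => y yu; case: nu; exists y.
by exists g => x; exact: gP.
Qed.

(** * Linear independence modulo a subspace *)

Section LinearAlgebra.
Variables (R : realType) (V : lmodType R).
Implicit Types (C D H W : set V) (l : seq (R * V)).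

(** A list of pairs is a formal linear combination in which a vector may be repeated, so that
    addition is concatenation. *)
Definition coef l (y : V) : R := \sum_(p <- l | p.2 == y) p.1.

(** Links formal combinations to the duplicate-free ones of [lin_indep]. The map [G] allows the same
    regrouping for images of the vectors, as [lin_extension] requires. *)
Lemma lincomb_undup (U : lmodType R) (G : V -> U) l :
  \sum_(p <- l) p.1 *: G p.2 =
  \sum_(y <- undup [seq p.2 | p <- l]) coef l y *: G y.
Proof.
under [RHS]eq_bigr do rewrite scaler_suml.
rewrite (exchange_big_dep xpredT)//=; apply: eq_big_seq => p pl.
rewrite -big_filter (_ : [seq _ <- _ | _] = [:: p.2]) ?big_seq1//.
rewrite -[RHS](@filter_pred1_uniq _ (undup [seq p.2 | p <- l]))//.
- by apply: eq_filter => y; rewrite /= eq_sym.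
- exact: undup_uniq.
- by rewrite mem_undup map_f.
Qed.

Lemma coef_cat l l' y : coef (l ++ l') y = coef l y + coef l' y.
Proof. by rewrite /coef big_cat. Qed.

Lemma coef_notin l y : y \notin [seq p.2 | p <- l] -> coef l y = 0.
Proof.
move=> yl; rewrite /coef big1_seq// => p /andP[/eqP py pl].
by rewrite -py map_f in yl.
Qed.

Lemma coef_graph (s : seq V) (c : V -> R) y : uniq s -> y \in s ->
  coef [seq (c x, x) | x <- s] y = c y.
Proof.
move=> us ys; rewrite /coef big_map/= -big_filter.
by rewrite (@filter_pred1_uniq _ s) ?big_seq1.
Qed.

Lemma linear_subspaceP W : linear_subspace W <->
  W 0 /\ forall a u v, W u -> W v -> W (a *: u + v).
Proof.
split=> -[W0 WD].
  split; first by rewrite inE in W0.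
  by move=> a u v Wu Wv; apply/set_mem/WD; rewrite inE.
split; first exact/mem_set.
by move=> a u v; rewrite !inE; exact: WD.
Qed.

Lemma linear_subspace_sum W (I : eqType) (r : seq I) (c : I -> R) (F : I -> V) :
  linear_subspace W -> (forall i, i \in r -> W (F i)) ->
  W (\sum_(i <- r) c i *: F i).
Proof.
move=> /linear_subspaceP[W0 WD]; elim: r => [|i r IH] rW; first by rewrite big_nil.
rewrite big_cons; apply: WD; first by apply: rW; rewrite mem_head.
by apply: IH => j jr; apply: rW; rewrite inE jr orbT.
Qed.

Lemma lin_spanP D v : lin_span D v <->
  exists2 l, (forall p, p \in l -> D p.2) & v = \sum_(p <- l) p.1 *: p.2.
Proof.
split=> [[s [c [sD ->]]]|[l lD ->]].
  exists [seq (c x, x) | x <- s]; last by rewrite big_map.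
  by move=> _ /mapP[x xs ->]; exact: sD.
exists (undup [seq p.2 | p <- l]), (coef l); split.
  by move=> x /=; rewrite mem_undup => /mapP[p pl ->]; exact: lD.
exact: (lincomb_undup id).
Qed.

Lemma lin_span_uniq D v : lin_span D v -> exists s c,
  [/\ uniq s, [set` s] `<=` D & v = \sum_(x <- s) c x *: x].
Proof.
move=> /lin_spanP[l lD ->]; exists (undup [seq p.2 | p <- l]), (coef l).
split; [exact: undup_uniq| |exact: (lincomb_undup id)].
by move=> x /=; rewrite mem_undup => /mapP[p pl ->]; exact: lD.
Qed.

Lemma lin_span_subspace D : linear_subspace (lin_span D).
Proof.
apply/linear_subspaceP; split=> [|a u v].
  by apply/lin_spanP; exists [::]; rewrite ?big_nil.
move=> /lin_spanP[k kD ->] /lin_spanP[l lD ->]; apply/lin_spanP.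
exists ([seq (a * p.1, p.2) | p <- k] ++ l).
  by move=> p; rewrite mem_cat => /orP[/mapP[q qk ->]|/lD//]; exact: (kD q).
rewrite big_cat big_map/= scaler_sumr; congr (_ + _).
by apply: eq_bigr => p _; rewrite scalerA.
Qed.

Lemma sub_lin_span D : D `<=` lin_span D.
Proof.
move=> x Dx; apply/lin_spanP; exists [:: (1, x)].
  by move=> p; rewrite inE => /eqP ->.
by rewrite big_seq1 scale1r.
Qed.

Lemma lin_span_min D W : linear_subspace W -> D `<=` W -> lin_span D `<=` W.
Proof.
move=> Wl DW _ [s [c [sD ->]]]; apply: linear_subspace_sum => // x /sD; exact: DW.
Qed.

(** For a subspace [C] this is independence of the classes of [H] in the quotient by [C], without
    forming the quotient. *)
Definition indep_mod C H : Prop :=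
  forall (s : seq V) (c : V -> R), uniq s -> [set` s] `<=` H ->
    C (\sum_(x <- s) c x *: x) -> forall x, x \in s -> c x = 0.

Lemma indep_modS C H D : D `<=` H -> indep_mod C H -> indep_mod C D.
Proof. by move=> DH CH s c us sD; apply: CH => // x /sD /DH. Qed.

Lemma indep_mod_coef C H l : indep_mod C H -> (forall p, p \in l -> H p.2) ->
  C (\sum_(p <- l) p.1 *: p.2) -> forall y, coef l y = 0.
Proof.
move=> CH lH; rewrite (lincomb_undup id) => Cl y.
have [yl|/coef_notin//] := boolP (y \in [seq p.2 | p <- l]).
apply: (CH _ _ (undup_uniq _) _ Cl); last by rewrite mem_undup.
by move=> x /=; rewrite mem_undup => /mapP[p pl ->]; exact: lH.
Qed.

Lemma indep_mod_hamel_basis C D : C 0 -> indep_mod C D ->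
  hamel_basis (lin_span D) D.
Proof.
by move=> C0 CD; split=> // s c us sD s0; apply: CD => //; rewrite s0.
Qed.

Lemma indep_mod_lin_span C D v : indep_mod C D -> lin_span D v -> C v -> v = 0.
Proof.
move=> CD /lin_span_uniq[s [c [us sD ->]]] /(CD _ _ us sD) c0.
by rewrite big1_seq// => x xs; rewrite c0// scale0r.
Qed.

(** Passes from indexed families to sets. A repeated member would give the combination with
    coefficients 1 and -1, whose sum 0 lies in [C]. *)
Lemma indep_mod_range (I : eqType) (h : I -> V) C : C 0 ->
  (forall (s : seq I) (c : I -> R), uniq s -> C (\sum_(i <- s) c i *: h i) ->
    forall i, i \in s -> c i = 0) ->
  injective h /\ indep_mod C (range h).
Proof.
move=> C0 hC; split=> [i j hij|s c us sh Cs x xs].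
  apply: contrapT => /eqP ij; have /eqP := @oner_eq0 R; apply.
  have := hC [:: i; j] (fun k => if k == i then 1 else -1).
  move=> /(_ _ _ i); rewrite eqxx; apply; rewrite ?mem_head//=.
    by rewrite inE ij.
  rewrite !big_cons big_nil eqxx eq_sym (negbTE ij) hij.
  by rewrite addr0 scale1r scaleN1r subrr.
have [i0 _ _] := sh x xs.
have /choice[a aP] f : exists i, range h f -> h i = f.
  by have [[i _ <-]|nf] := pselect (range h f); [exists i|exists i0].
have {}aP f : f \in s -> h (a f) = f by move=> /sh; exact: aP.
rewrite -(aP x xs); apply: (hC (map a s) (c \o h)); last exact: map_f.
  by rewrite map_inj_in_uniq// => f g fs gs afg; rewrite -(aP f)// afg aP.
rewrite big_map; congr C: Cs.
by apply: eq_big_seq => f fs; rewrite /= aP.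
Qed.

Lemma lin_extension (U : lmodType R) (B : set V) (g : V -> U) :
  hamel_basis [set: V] B ->
  exists2 f : V -> U, linear f & forall b, B b -> f b = g b.
Proof.
move=> [Bind Bspan].
have /choice[rep repP] x : exists l : seq (R * V),
    (forall p, p \in l -> B p.2) /\ x = \sum_(p <- l) p.1 *: p.2.
  have /lin_spanP[l lB xE] : lin_span B x by rewrite Bspan.
  by exists l.
pose f x := \sum_(p <- rep x) p.1 *: g p.2.
(* The value of [f] does not depend on the chosen representation: the formal difference [l'] of two
   representations has only zero coefficients, by independence of [B]. *)
have fE l : (forall p, p \in l -> B p.2) ->
    f (\sum_(p <- l) p.1 *: p.2) = \sum_(p <- l) p.1 *: g p.2.
  move=> lB; set x := (X in f X); have [rB xE] := repP x.
  pose l' := l ++ [seq (- p.1, p.2) | p <- rep x].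
  have l'0 : \sum_(p <- l') p.1 *: p.2 = 0.
    rewrite big_cat big_map/=; under [X in _ + X]eq_bigr do rewrite scaleNr.
    by rewrite sumrN -xE subrr.
  have l'B p : p \in l' -> B p.2.
    by rewrite mem_cat => /orP[/lB//|/mapP[q qx ->]]; exact: (rB q).
  have c0 : forall y, coef l' y = 0.
    by apply: (@indep_mod_coef [set 0] B).
  have : \sum_(p <- l') p.1 *: g p.2 = 0.
    by rewrite lincomb_undup big1// => y _; rewrite c0 scale0r.
  rewrite big_cat big_map/=; under [X in _ + X]eq_bigr do rewrite scaleNr.
  by rewrite sumrN => /subr0_eq.
exists f => [a x y|b Bb].
  have [xB xE] := repP x; have [yB yE] := repP y.
  rewrite {1}xE {1}yE scaler_sumr.
  under eq_bigr do rewrite scalerA.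
  have := fE ([seq (a * p.1, p.2) | p <- rep x] ++ rep y).
  rewrite !big_cat !big_map/= => ->.
    by rewrite scaler_sumr; under eq_bigr do rewrite -scalerA.
  by move=> p; rewrite mem_cat => /orP[/mapP[q qk ->]|/yB//]; exact: (xB q).
have := fE [:: (1, b)]; rewrite !big_seq1/= !scale1r; apply.
by move=> p; rewrite inE => /eqP ->.
Qed.

(** If adjoining [w] to [C] makes [H] dependent, the relation involves [w] with a nonzero
    coefficient, as [H] is independent modulo [C]. Dropping any [h] with nonzero coefficient in it
    restores independence. *)
Lemma indep_mod_exchange1 C H (w : V) : linear_subspace C -> indep_mod C H ->
  exists C' h, [/\ linear_subspace C', C `<=` C', C' w &
    indep_mod C' (H `\ h)].
Proof.
move=> /linear_subspaceP[C0 CD] CH.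
(* This is the sum of [C] and the span of [w]. *)
pose C' := [set v | exists a, C (v + a *: w)].
suff [h hP] : exists h, indep_mod C' (H `\ h).
  exists C', h; split=> //.
  - apply/linear_subspaceP; split; first by exists 0; rewrite add0r scale0r.
    move=> a u v [b Cu] [c Cv]; exists (a * b + c).
    by have := CD a _ _ Cu Cv; rewrite scalerDr scalerDl scalerA addrACA.
  - by move=> v Cv; exists 0; rewrite scale0r addr0.
  - by exists (-1); rewrite scaleN1r subrr.
have [C'H|] := pselect (indep_mod C' H).
  by exists w; apply: indep_modS C'H; exact: subDsetl.
move=> /existsNP[s /existsNP[c /not_implyP[us /not_implyP[sH]]]].
move=> /not_implyP[[a Ca] /existsNP[h /not_implyP[hs /eqP ch]]].
have a0 : a != 0.
  apply: contra_neq ch => a0; apply: (CH s) => //.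
  by move: Ca; rewrite a0 scale0r addr0.
exists h => s' c' us' s'H [a' Ca'].
(* [w] is eliminated between the two relations. As [h] is absent from [s'], its coefficient in [l]
   is [- (a' / a) * c h], which must vanish; hence [a' = 0] and the second relation holds modulo
   [C]. *)
pose l := [seq (c' x, x) | x <- s'] ++ [seq (- (a' / a) * c x, x) | x <- s].
have lC : C (\sum_(p <- l) p.1 *: p.2).
  rewrite big_cat !big_map/=; under [X in _ + X]eq_bigr do rewrite -scalerA.
  rewrite -scaler_sumr; have := CD (- (a' / a)) _ _ Ca Ca'.
  rewrite scalerDr scalerA mulNr divfK// addrACA (scaleNr a' w) addNr.
  by rewrite addr0 addrC.
have lH p : p \in l -> H p.2.
  by rewrite mem_cat => /orP[]/mapP[x xs ->]; [case: (s'H _ xs)|exact: sH].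
have := indep_mod_coef CH lH lC h; rewrite coef_cat coef_notin; last first.
  by rewrite -map_comp map_id; apply/negP => /s'H[_]; exact.
rewrite add0r (coef_graph (fun x => - (a' / a) * c x))// => /eqP.
rewrite mulf_eq0 (negbTE ch) orbF oppr_eq0 mulf_eq0 invr_eq0 (negbTE a0) orbF.
move=> /eqP a'0; move: Ca'; rewrite a'0 scale0r addr0; apply: CH => //.
by move=> x /s'H[].
Qed.

Lemma indep_mod_exchange C H (t : seq V) : linear_subspace C -> indep_mod C H ->
  exists C' (r : seq V), [/\ linear_subspace C', C `<=` C', [set` t] `<=` C' &
    indep_mod C' (H `\` [set` r])].
Proof.
move=> Cl CH; elim: t => [|w t [C' [r [C'l CC' tC' C'H]]]].
  by exists C, [::]; split=> //; apply: indep_modS CH; exact: subDsetl.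
have [C'' [h [C''l C'C'' C''w C''H]]] := indep_mod_exchange1 w C'l C'H.
exists C'', (h :: r); split=> //; first exact: subset_trans C'C''.
  by move=> x /=; rewrite inE => /orP[/eqP->//|/tC'/C'C''].
apply: indep_modS C''H => x [Hx /= xr]; split; first split=> //.
  by move=> /= xr'; apply: xr; rewrite inE xr' orbT.
by move=> /= xh; apply: xr; rewrite xh mem_head.
Qed.

(** Modulo [C'] only the part of a combination in [H] remains, so its coefficients vanish. The rest
    then lies in both [C] and the span of [D], hence is 0, and [D] is independent. *)
Lemma indep_mod_setU C C' D H : linear_subspace C' -> C `<=` C' -> D `<=` C' ->
  lin_indep D -> (forall v, lin_span D v -> C v -> v = 0) -> indep_mod C' H ->
  indep_mod C (D `|` H).
Proof.
move=> C'l CC' DC' Di DC0 C'H s c us sDH Cs.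
pose P : pred V := fun x => x \in H.
pose sH := [seq x <- s | P x]; pose sD := [seq x <- s | ~~ P x].
have sE : \sum_(x <- s) c x *: x =
    \sum_(x <- sH) c x *: x + \sum_(x <- sD) c x *: x.
  by rewrite !big_filter [LHS](bigID P).
have DsD : [set` sD] `<=` D.
  move=> x /=; rewrite mem_filter => /andP[/= /negP xH /sDH[//|Hx]].
  by case: xH; exact: mem_set.
have cH x : x \in sH -> c x = 0.
  apply: (C'H sH) => //; first exact: filter_uniq.
    by move=> y /=; rewrite mem_filter => /andP[/set_mem].
  have C'D : C' (\sum_(x <- sD) c x *: x).
    by apply: linear_subspace_sum => // y /DsD /DC'.
  have /linear_subspaceP[_ CD] := C'l.
  have := CD (-1) _ _ C'D (CC' _ Cs).
  by rewrite sE scaleN1r addrC addrK.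
have sD0 : \sum_(x <- sD) c x *: x = 0.
  apply: DC0; first by exists sD, c.
  move: Cs; rewrite sE [X in X + _]big1_seq ?add0r// => x xs.
  by rewrite cH// scale0r.
move=> x xs; have [xH|xH] := boolP (P x); first by rewrite cH// mem_filter xH.
by apply: (Di _ _ (filter_uniq _ us) DsD sD0); rewrite mem_filter /= xH.
Qed.

End LinearAlgebra.

(** * Multilinear forms *)

Section ContinuousLinear.
Variables (R : realType) (E : normedModType R).

Lemma continuous_linear_le (f : E -> R^o) : linear f -> continuous f ->
  exists M, forall x, `|f x| <= M * `|x|.
Proof.
move=> fl fc.
pose F : {linear E -> R^o} := HB.pack f (GRing.isLinear.Build R E R^o _ f fl).
have /linear_boundedP[M [_ /(_ (M + 1))]] : bounded_near F (nbhs 0).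
  by apply: continuous_linear_bounded; exact: (fc 0).
by rewrite ltrDl => /(_ ltr01) h; exists (M + 1).
Qed.

End ContinuousLinear.

Section MultilinearForms.
Variables (R : realType) (m : nat) (E : normedModType R).

Lemma mlin_linear (F : lmodType R) (f : mlin m E F) v i :
  linear (fun x => f (dfwith v i x)).
Proof. by case: f => f /= /asboolP; exact. Qed.

Lemma mlin_sumE (F : lmodType R) (I : Type) (r : seq I) (c : I -> R)
    (f : I -> mlin m E F) v :
  (\sum_(i <- r) c i *: f i) v = \sum_(i <- r) c i *: f i v.
Proof. by elim: r => [|i r IH]; rewrite ?big_nil// !big_cons -IH. Qed.

Lemma prod_multilinear (chi : 'I_m -> E -> R^o) : (forall i, linear (chi i)) ->
  @multilinear R m E R^o (fun v => \prod_i chi i (v i)).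
Proof.
move=> chil v i a x y.
have E' z : \prod_j chi j (dfwith v i z j) =
      chi i z * \prod_(j | j != i) chi j (v j).
  rewrite (bigD1 i)//= dfwithin; congr (_ * _).
  by apply: eq_bigr => j ji; rewrite dfwithout// eq_sym.
by rewrite !E' chil mulrDl scalerAl.
Qed.

Lemma mlin_basis_inj (T : Type) (e : T -> E) (F : lmodType R) (f g : mlin m E F) :
  lin_span (range e) = [set: E] ->
  (forall u : 'I_m -> T, f (e \o u) = g (e \o u)) -> f = g.
Proof.
move=> espan fg.
(* Induction on [k]: one further coordinate is expanded in the spanning family at each step, until
   all [m] coordinates are arbitrary. *)
suff fgk k v : (forall i : 'I_m, (k <= i)%N -> range e (v i)) -> f v = g v.
  apply: val_inj; apply/funext => v; apply: (fgk m) => i.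
  by rewrite leqNgt ltn_ord.
elim: k v => [|k IH] v vk.
  have /choice[u uE] i : exists t, e t = v i by have [t _ <-] := vk i isT; exists t.
  by rewrite (_ : v = e \o u) ?fg//; apply/funext => i; rewrite /= uE.
have [km|mk] := ltnP k m; last first.
  by apply: IH => i ki; have := leq_trans mk ki; rewrite leqNgt ltn_ord.
pose i := Ordinal km.
have vE : v = dfwith v i (v i).
  apply/funext => j; have [->|ji] := eqVneq j i; first by rewrite dfwithin.
  by rewrite dfwithout// eq_sym.
have [s [c [se viE]]] : lin_span (range e) (v i) by rewrite espan.
have expand (h : mlin m E F) : h v = \sum_(x <- s) c x *: h (dfwith v i x).
  rewrite {1}vE viE.
  pose H : {linear E -> F} := HB.pack (fun x => h (dfwith v i x))
    (GRing.isLinear.Build R E F _ (fun x => h (dfwith v i x)) (mlin_linear h v i)).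
  rewrite -[LHS]/(H _) linear_sum; apply: eq_bigr => x _.
  by rewrite linearZ.
rewrite !expand; apply: eq_big_seq => x xs; congr (_ *: _); apply: IH => j kj.
have [->|ji] := eqVneq j i; first by rewrite dfwithin; exact: se.
rewrite dfwithout 1?eq_sym//; apply: vk.
by rewrite ltn_neqAle kj andbT; apply: contra ji => /eqP kE; apply/eqP/val_inj.
Qed.

Lemma mlin_set_inj (T : Type) (e : T -> E) : infinite_set [set: T] ->
  lin_span (range e) = [set: E] ->
  exists F : mlin m E R^o -> set T, injective F.
Proof.
move=> Tinf espan.
(* As [T] is infinite, pairs of a list over [T] and a rational embed into [T], and so do the power
   sets. *)
have [j ji] : exists j : set (seq T * rat) -> set T, injective j.
  apply: image_set_inj; apply: infinite_prod_inj => //.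
    by apply: infinite_seq_inj => //; exists id.
  exact: infinite_countable_inj.
have [t _] := infinite_setN0 Tinf.
(* Tuples of indices are encoded as lists, with [t] as the default past the end; the comparison
   below uses lists that enumerate a whole [u]. *)
pose F (f : mlin m E R^o) : set (seq T * rat) :=
  [set p | ratr p.2 < f (fun i => e (nth t p.1 i)) :> R].
exists (j \o F) => f g /ji fg; apply: (mlin_basis_inj espan) => u.
have FE (h : mlin m E R^o) q : F h ([seq u i | i <- enum 'I_m], q) =
    (ratr q < h (e \o u)).
  rewrite /F /=; congr (is_true (_ < h _)); apply/funext => i /=.
  by rewrite (nth_map i) ?size_enum_ord// nth_ord_enum.
have {FE fg} lt_eq q : (ratr q < f (e \o u)) = (ratr q < g (e \o u)).
  by apply/idP/idP; rewrite -!FE fg.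
have [lt|lt|//] := ltgtP (f (e \o u)) (g (e \o u)).
- have [q] := rat_in_itvoo lt; rewrite in_itv /= => /andP[q1 q2].
  by move: q2; rewrite -lt_eq ltNge (ltW q1).
- have [q] := rat_in_itvoo lt; rewrite in_itv /= => /andP[q1 q2].
  by move: q2; rewrite lt_eq ltNge (ltW q1).
Qed.

Definition cont_forms : set (mlin m E R^o) :=
  [set f | continuous (f : {ptws 'I_m -> E} -> R^o)].

Lemma cont_forms_subspace : linear_subspace cont_forms.
Proof.
apply/linear_subspaceP; split=> [|a f g].
  exact: (@cst_continuous {ptws 'I_m -> E} R^o 0).
rewrite /cont_forms /= => fc gc.
change (continuous ((fun v => a *: (f v : R^o) + (g v : R^o)) :
  {ptws 'I_m -> E} -> R^o)).
move=> v; apply: (@continuousD _ R^o {ptws 'I_m -> E} (fun v => a *: f v) g v).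
  by apply: (@continuousZl_tmp _ R^o {ptws 'I_m -> E} f a v); exact: fc.
exact: gc.
Qed.

End MultilinearForms.

(** * A large family independent modulo the continuous forms *)

(** A list of pairs prescribes membership for finitely many points. For infinite [T] such lists
    embed into [T], although they distinguish among all subsets of [T]. *)
Definition pattern (T : Type) (s : seq (T * bool)) (A : set T) : bool :=
  all (fun p => `[< A p.1 >] == p.2) s.

(** Each set of [r] other than [A] contributes one condition, at a point where it differs from
    [A]. *)
Lemma separating_pattern (T : Type) (A : set T) (r : seq (set T)) :
  exists2 s, pattern s A & forall B, B \in r -> B != A -> ~~ pattern s B.
Proof.
elim: r => [|B r [s sA sr]]; first by exists [::].
have [->|BA] := eqVneq B A.
  by exists s => // D; rewrite inE => /orP[/eqP->|/sr//]; rewrite eqxx.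
have [t tBA] : exists t, `[< B t >] != `[< A t >].
  apply: contrapT => nt; move/eqP: BA; apply; apply/funext => t.
  apply/propext; rewrite -(asboolE (B t)) -(asboolE (A t)).
  suff -> : `[< B t >] = `[< A t >] by [].
  by apply/eqP/negP => /negP tBA; apply: nt; exists t.
exists ((t, `[< A t >]) :: s); first by rewrite /pattern /= eqxx.
move=> D; rewrite inE => /orP[/eqP->|Dr DA]; rewrite /pattern /= negb_and ?tBA//.
by rewrite -/(pattern s D) (sr D Dr DA) orbT.
Qed.

Section DiscontinuousFamily.
Variables (R : realType) (m : nat) (E : normedModType R).
Variables (T : Type) (e : T -> E).
Hypotheses (Tinf : infinite_set [set: T]) (einj : injective e).
Hypothesis ebasis : hamel_basis [set: E] (range e).

Lemma basis_lin_extension (g : T -> R^o) :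
  exists2 f : E -> R^o, linear f & forall t, f (e t) = g t.
Proof.
have [t _] := infinite_setN0 Tinf.
have [e' eK] := inj_left_inverse (inhabits t) einj.
have [f fl fE] := lin_extension (g \o e') ebasis.
by exists f => // u; rewrite fE /= ?eK//; exists u.
Qed.

Lemma basis_neq0 t : e t != 0.
Proof.
apply/eqP => et0; have [eind _] := ebasis.
have /eqP := @oner_eq0 R; apply.
apply: (eind [:: e t] (fun=> 1) isT _ _ (e t)); rewrite ?mem_head//.
  by move=> x /=; rewrite inE => /eqP->; exists t.
by rewrite big_seq1 et0 scaler0.
Qed.

(* The forms are v |-> phi (v 0) * \prod_(i > 0) psi (v i) with psi fixed. The
   basis is indexed by triples (s, l', k), and phi takes at the basis vector b
   of index (s, l', k) the value k * |b| if s is a pattern of A and l' = l, and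
   0 otherwise. If s separates A from the other sets of a linear combination,
   its coefficient at (A, l) is multiplied by k along the vectors (s, l, k). *)
Lemma discontinuous_family : (0 < m)%N ->
  exists2 h : set T * nat -> mlin m E R^o,
    injective h & indep_mod (@cont_forms R m E) (range h).
Proof.
move=> m_gt0; pose i0 := Ordinal m_gt0.
have [t _] := infinite_setN0 Tinf.
have [iota iotai] : exists iota : seq (T * bool) * nat * nat -> T, injective iota.
  apply: infinite_prod_inj => //; last exact: infinite_countable_inj.
  apply: infinite_prod_inj => //; last exact: infinite_countable_inj.
  apply: infinite_seq_inj => //; apply: infinite_prod_inj => //; first by exists id.
  exact: infinite_countable_inj.
(* Off the range of [iota] the triple [kap u] is arbitrary; the coefficients are tested only at
   vectors [e (iota _)]. *)
have [kap iotaK] := inj_left_inverse (inhabits ([::], 0%N, 0%N)) iotai.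
pose G (a : set T * nat) u : R^o := let: (s, l, k) := kap u in
  k%:R * `|e u| * (pattern s a.1 && (l == a.2))%:R.
have /choice[phi phiP] a : exists f : E -> R^o,
    linear f /\ forall u, f (e u) = G a u.
  by have [f fl fE] := basis_lin_extension (G a); exists f.
(* With value 1 on the basis, [psi] contributes trivial factors when all coordinates but the first
   are fixed at [e t]. *)
have [psi psil psi1] := basis_lin_extension (fun=> 1).
pose chi a i := if i == i0 then phi a else psi.
have chil a i : linear (chi a i).
  by rewrite /chi; case: ifP => // _; have [] := phiP a.
pose h a : mlin m E R^o := MLin (asboolT (prod_multilinear (chil a))).
have hE a x : h a (dfwith (fun=> e t) i0 x) = phi a x.
  rewrite /= (bigD1 i0)//= dfwithin /chi eqxx big1 ?mulr1// => i ii0.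
  by rewrite (negbTE ii0) dfwithout 1?eq_sym// psi1.
suff hC (s : seq (set T * nat)) c : uniq s ->
    cont_forms (\sum_(a <- s) c a *: h a) -> forall a, a \in s -> c a = 0.
  have [||hi hH] := @indep_mod_range R _ (set T * nat)%type h (@cont_forms R m E).
  - by have /linear_subspaceP[] := cont_forms_subspace m E.
  - exact: hC.
  - by exists h.
move=> us Cs [A l] As.
(* This is the combination as a function of its first coordinate, the others being [e t]; it
   inherits linearity and continuity, hence a bound [M]. *)
pose f (x : E) : R^o := \sum_(a <- s) c a *: phi a x.
have fl : linear f.
  move=> a x y; rewrite /f scaler_sumr -big_split/=; apply: eq_bigr => b _.
  have [-> _] := phiP b; rewrite scalerDr; congr (_ + _).
  by rewrite !scalerA mulrC.
have fc : continuous f.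
  have -> : f = (fun x => (\sum_(a <- s) c a *: h a) (dfwith (fun=> e t) i0 x)).
    by apply/funext => x; rewrite mlin_sumE; apply: eq_bigr => a _; rewrite hE.
  move=> x.
  apply: (@continuous_comp E {ptws 'I_m -> E} R^o
    (dfwith (fun=> e t) i0)); last exact: Cs.
  exact: (@dfwith_continuous _ (fun=> E)).
have [M fM] := continuous_linear_le fl fc.
have [sg sgA sgs] := separating_pattern A [seq a.1 | a <- s].
(* Only the term of [(A, l)] survives: [sg] excludes the sets other than [A], and the second index
   excludes the other terms with the set [A]. *)
have fE k : f (e (iota (sg, l, k))) = c (A, l) * (k%:R * `|e (iota (sg, l, k))|).
  rewrite /f (bigD1_seq (A, l))//= big1_seq ?addr0.
    by have [_ ->] := phiP (A, l); rewrite /G iotaK /= sgA eqxx mulr1.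
  move=> [B l'] /andP[Bl Bs]; have [_ ->] := phiP (B, l'); rewrite /G iotaK /=.
  have [BA|BA] := eqVneq B A; last first.
    by rewrite (negbTE (sgs _ _ BA)) ?mulr0 ?scaler0//; exact: (map_f fst Bs).
  have -> : (l == l') = false.
    by apply/eqP => ll'; move/eqP: Bl; apply; rewrite BA ll'.
  by rewrite andbF mulr0 scaler0.
(* [M] does not depend on [k], so a nonzero coefficient is refuted by a [k] above the quotient of
   [M] by its absolute value. *)
have cM k : `|c (A, l)| * k%:R <= M.
  have := fM (e (iota (sg, l, k))); rewrite fE mulrA normrM normr_id normrM.
  by rewrite normr_nat ler_pM2r// normr_gt0 basis_neq0.
apply: contrapT => /eqP c0.
have := cM (Num.bound `|M / `|c (A, l)| |).
rewrite -ler_pdivlMl ?normr_gt0// mulrC leNgt => /negP; apply.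
exact: le_lt_trans (ler_norm _) (archi_boundP (normr_ge0 _)).
Qed.

End DiscontinuousFamily.

(** * Lineability *)

Lemma card_pow2_setT (K : Type) (D : set K) :
  card_pow2 D #= [set: set (set_type D)].
Proof.
have -> : card_pow2 D = (fun A : set (set_type D) => set_val @` A) @` setT.
  apply/seteqP; split=> [X XD|_ [A _ <-] _ [x _ <-]]; last exact: set_valP.
  exists (set_val @^-1` X) => //; apply/seteqP; split=> [_ [x Xx <-]//|x Xx].
  by exists (SigSub (mem_set (XD x Xx))).
apply: inj_card_eq => A B _ _ AB; apply/funext => x.
have vi : injective (set_val : set_type D -> K) by exact: val_inj.
by rewrite -(image_inj vi (A := A)) AB (image_inj vi).
Qed.

Section Lineability.
Variables (R : realType) (E : normedModType R).
Variables (K : Type) (dimE : set K).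
Hypothesis dimE_def : has_dim [set: E] dimE.
Hypothesis dimE_infinite : infinite_set dimE.
Variable m : nat.

Lemma infinite_dim_type : infinite_set [set: set_type dimE].
Proof.
move=> fin; apply: dimE_infinite.
by rewrite -(eq_finite_set (card_setT dimE)).
Qed.

Lemma dim_basis : exists2 e : set_type dimE -> E,
  injective e & hamel_basis [set: E] (range e).
Proof.
have [B Bbasis] := dimE_def.
move=> /card_esym /card_set_bijP[f [fB finj fsurj]].
exists (f \o set_val).
  move=> x y /= fxy; apply: val_inj; apply: finj => //; apply/mem_set;
    exact: set_valP.
rewrite (_ : range _ = B)//; apply/seteqP; split=> [_ [x _ <-]|b Bb].
  by apply: fB; exact: set_valP.
by have [x xD <-] := fsurj b Bb; exists (SigSub (mem_set xD)).
Qed.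

Lemma mlin_card_le (D : set (mlin m E R^o)) : D #<= card_pow2 dimE.
Proof.
have [e _ [_ espan]] := dim_basis.
have [F Finj] := mlin_set_inj m infinite_dim_type espan.
rewrite (card_le_eqr (card_pow2_setT dimE)).
apply: card_le_trans (card_leT D) _.
by apply/(card_leT_injP _ (inhabits set0)); exists F.
Qed.

Lemma card_lt_II_pow2 n : card_lt `I_n (card_pow2 dimE).
Proof.
have infP : infinite_set (card_pow2 dimE).
  apply/infiniteP; rewrite (card_le_eqr (card_pow2_setT dimE)).
  have [f fi] := infinite_nat_inj infinite_dim_type.
  apply/(card_leT_injP _ (inhabits set0)).
  (* Singletons of an infinite sequence of points show that the power set is infinite. *)
  exists (fun k => [set f k]) => k l kl; apply: fi.
  by have : [set f k] (f k) by []; rewrite kl.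
split; last by move=> /card_le_finite /(_ (finite_II n)).
by apply: card_le_trans (card_leT _) _; exact/infiniteP.
Qed.

(** Independence modulo the continuous forms makes 0 the only continuous form in the span. *)
Lemma indep_mod_lineable (U : Type) (b : set U) (D : set (mlin m E R^o)) :
  indep_mod (@cont_forms R m E) D -> D #= b ->
  [/\ linear_subspace (lin_span D), has_dim (lin_span D) b &
    lin_span D `<=` NL m E R^o `|` [set 0]].
Proof.
move=> CD Db; split; first exact: lin_span_subspace.
  exists D => //; apply: indep_mod_hamel_basis CD.
  by have /linear_subspaceP[] := cont_forms_subspace m E.
move=> v Dv; have [cv|] := pselect (cont_forms v); last by left.
by right; exact: indep_mod_lin_span CD Dv cv.
Qed.

Lemma lineable2_NL_pow2 n : (0 < m)%N ->
  lineable2 `I_n (card_pow2 dimE) (NL m E R^o).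
Proof.
move=> m_gt0.
have [e einj ebasis] := dim_basis.
have [h hinj hind] := discontinuous_family infinite_dim_type einj ebasis m_gt0.
split; first exact: card_lt_II_pow2.
  (* For plain lineability, [n] members of the family suffice, here those with the empty set and
     index below [n]. *)
  pose D := (fun l => h (set0, l)) @` `I_n.
  exists (lin_span D); apply: indep_mod_lineable.
    by apply: indep_modS hind => _ [l _ <-]; exists (set0, l).
  by apply: inj_card_eq => k l _ _ /hinj[].
move=> Wa _ WaNL [Da [Dai DaE] Dan].
have [t tE] : exists t : seq (mlin m E R^o), Da = [set` t].
  by apply/finite_seqP/finite_setP; exists n.
have [C' [r [C'l CC' tC' C'H]]] :=
  indep_mod_exchange t (cont_forms_subspace m E) hind.
(* The list [r] is finite, so every [l] above all second indices occurring in it works, for all sets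
   [A] at once. *)
have [l lr] : exists l, forall A, h (A, l) \notin r.
  suff [N Nr] : exists N, forall l A, (N <= l)%N -> h (A, l) \notin r.
    by exists N => A; exact: Nr.
  elim: (r) => [|f r' [N IH]]; first by exists 0%N.
  have [[[A0 l0] fE]|nf] := pselect (exists a, h a = f); last first.
    exists N => l A Nl; rewrite inE negb_or IH// andbT.
    by apply/eqP => hf; apply: nf; exists (A, l).
  exists (maxn N l0.+1) => l A; rewrite geq_max => /andP[Nl l0l].
  rewrite inE negb_or IH// andbT -fE; apply/eqP => /hinj[_ ll0].
  by rewrite ll0 ltnn in l0l.
pose H := range (fun A => h (A, l)).
have Cind : indep_mod (@cont_forms R m E) (Da `|` H).
  apply: (indep_mod_setU C'l CC') => //; first by rewrite tE.
    by rewrite DaE => v /WaNL[nv /nv|->].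
  apply: indep_modS C'H => _ [A _ <-]; split; first by exists (A, l).
  by move=> /= rA; move/negP: (lr A).
(* The upper bound is the count of all forms; the lower one comes from [H], which has one member for
   each subset of the basis index. *)
have Dcard : Da `|` H #= card_pow2 dimE.
  rewrite card_eq_le mlin_card_le (card_le_eql (card_pow2_setT dimE)) /=.
  apply: card_le_trans (_ : H #<= _); last exact: subset_card_le (@subsetUr _ _ _).
  have /card_eqPle[_] : H #= [set: set (set_type dimE)]; last by [].
  by apply: inj_card_eq => A B _ _ /hinj[].
have [Ws Wd WNL] := indep_mod_lineable Cind Dcard.
exists (lin_span (Da `|` H)); split=> //.
rewrite -DaE; apply: lin_span_min => // x Dax.
by apply: sub_lin_span; left.
Qed.

End Lineability.

Unset Implicit Arguments.
Set Strict Implicit.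
Set Printing Implicit Defensive.

Theorem corollary2p8 (R : realType) (E : normedModType R)
    (K : Type) (dimE : set K)
    (dimE_def : has_dim [set: E] dimE) (dimE_infinite : infinite_set dimE)
    (m : nat) (m_gt0 : (0 < m)%N) (n : nat) (n_gt0 : (0 < n)%N) :
  lineable2 `I_n (card_pow2 dimE) (NL m E R^o) /\
  (forall (T : Type) (b : set T), card_lt (card_pow2 dimE) b ->
     ~ lineable2 `I_n b (NL m E R^o)).
Proof.
split; first exact: lineable2_NL_pow2.
(* Lineability supplies some [Wa] to extend; a basis of the extension has size [b] and consists of
   forms, so [b] is bounded by the count of all forms. *)
move=> T b [_ nb] [_ [Wa [Was Wad WaNL]] ext]; apply: nb.
have [Wb [_ [D _ Db] _ _]] := ext Wa Was WaNL Wad.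
by rewrite -(card_le_eql Db); exact: mlin_card_le.
Qed.
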